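(* Let $P$ be a positive integer, $N=2^L$ with $L$ a positive integer, $D_1,\ldots,D_{N^P},R$ positive integers, let $\mathcal{W}^P_{\mathrm{TN}}\in\mathbb{R}^{D_1\times\cdots\times D_{N^P}}$ be generated by the $P$-dimensional locally connected tensor network of width $R$, and let $\mu:[N]^P\to[N^P]$ be compatible. For any $\mathcal{A}\in\mathbb{R}^{D_1\times\cdots\times D_{N^P}}$ and $\epsilon\in[0,\|\mathcal{A}\|/4]$, if $\|\mathcal{W}^P_{\mathrm{TN}}-\mathcal{A}\|\le\epsilon$, then for all canonical partitions $(\mathcal{K},\mathcal{K}^c)\in\mathcal{C}^P_N$: $$\mathrm{QE}(\mathcal{A};\mu(\mathcal{K}))\le\ln(R)+\frac{2\epsilon}{\|\mathcal{A}\|}\ln(D_{\mu(\mathcal{K})})+2\sqrt{\frac{2\epsilon}{\|\mathcal{A}\|}}.$$ In contrast, there exists $\mathcal{A}'\in\mathbb{R}^{D_1\times\cdots\times D_{N^P}}$ such that for all $(\mathcal{K},\mathcal{K}^c)\in\mathcal{C}^P_N$: $\mathrm{QE}(\mathcal{A}';\mu(\mathcal{K}))\ge\min\{|\mathcal{K}|,|\mathcal{K}^c|\}\cdot\ln(\min_{n\in[N^P]}D_n)$.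
   Context: Norms are Frobenius. For a tensor $\mathcal{A}\in\mathbb{R}^{D_1\times\cdots\times D_{N^P}}$ and $\mathcal{J}\subseteq[N^P]$, $[\![\mathcal{A};\mathcal{J}]\!]$ is its matrix arrangement with rows indexed by axes $\mathcal{J}$ and columns by the remaining axes $\mathcal{J}^c$; $D_{\mathcal{J}}:=\min\{\prod_{n\in\mathcal{J}}D_n,\prod_{n\in\mathcal{J}^c}D_n\}$; $\mathrm{QE}(\mathcal{A};\mathcal{J}):=-\sum_d\rho_d\ln\rho_d$ with $\rho_d=\sigma_d^2/\sum_{d'}\sigma_{d'}^2$ over the singular values of $[\![\mathcal{A};\mathcal{J}]\!]$ ($\mathrm{QE}(0;\mathcal{J})=0$; $\epsilon/\|\mathcal{A}\|:=0$ if $\mathcal{A}=0$). The $P$-dimensional locally connected tensor network of width $R$ has as graph a perfect $2^P$-ary tree of height $L$ with $N^P$ leaves, open edge of leaf $n$ (left to right) of dimension $D_n$, inner edges of dimension $R$; it generates exactly the tensors: choose $\phi^{(0,n)}_r\in\mathbb{R}^{D_n}$ ($n\in[N^P]$, $r\in[R]$); for $l=1,\ldots,L-1$, $n\in[2^{P(L-l)}]$, $r\in[R]$ set $\phi^{(l,n)}_r=\sum_{i_1,\ldots,i_{2^P}\in[R]}a^{(l,n)}_{r,i_1,\ldots,i_{2^P}}\bigotimes_{k=1}^{2^P}\phi^{(l-1,2^P(n-1)+k)}_{i_k}$; and $\mathcal{W}^P_{\mathrm{TN}}=\sum_{i_1,\ldots,i_{2^P}}a_{i_1,\ldots,i_{2^P}}\bigotimes_{k=1}^{2^P}\phi^{(L-1,k)}_{i_k}$.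 Thus the axes descending from the $n$-th node at level $l$ form the contiguous index block $\{2^{Pl}(n-1)+1,\ldots,2^{Pl}n\}$. A bijection $\mu:[N]^P\to[N^P]$ is compatible if for every node, the set $\mu^{-1}$ of the axis indices descending from it is a contiguous cubic block of $[N]^P$ of the form $\times_{p=1}^P\{s(k_p-1)+1,\ldots,sk_p\}$; for $\mathcal{K}\subseteq[N]^P$, $\mu(\mathcal{K}):=\{\mu(\mathbf{n}):\mathbf{n}\in\mathcal{K}\}$. The canonical partitions $\mathcal{C}^P_N$ of $[N]^P$ are the pairs $(\mathcal{K},[N]^P\setminus\mathcal{K})$ with $\mathcal{K}=\times_{p=1}^P\{2^{L-l}(n_p-1)+1,\ldots,2^{L-l}n_p\}$ for $l\in\{0,\ldots,L\}$, $n_1,\ldots,n_P\in[2^l]$. *)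

(* Defs.v *)
From HB Require Import structures.
From mathcomp Require Import all_boot all_order all_algebra.
From mathcomp Require Import all_classical all_reals all_analysis.
Set Implicit Arguments. Unset Strict Implicit. Unset Printing Implicit Defensive.
Import Order.TTheory GRing.Theory Num.Theory.
Local Open Scope ring_scope.

Section Tensors.
Variable R : realType.

(* eigenvalues (with multiplicity) of a square matrix whose characteristic
   polynomial splits over R (as for symmetric matrices); chosen by choice. *)
Definition eigvals (k : nat) (G : 'M[R]_k) : seq R :=
  xget [::] (fun s : seq R =>
     size s = k /\ char_poly G = \prod_(x <- s) ('X - x%:P)).

(* singular values of M : sqrt of eigenvalues of M M^T (if m <= n) or of
   M^T M (otherwise); there are exactly min(m,n) of them. *)
Definition singular_values (m n : nat) (M : 'M[R]_(m, n)) : seq R :=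
  if (m <= n)%N then map Num.sqrt (eigvals (M *m M^T))
  else map Num.sqrt (eigvals (M^T *m M)).

Definition QE_mx (m n : nat) (M : 'M[R]_(m, n)) : R :=
  if M == 0 then 0 else
  let s := singular_values M in
  let tot := \sum_(x <- s) x ^+ 2 in
  - \sum_(x <- s) ((x ^+ 2 / tot) * ln (x ^+ 2 / tot)).

Variables (M : nat) (D : 'I_M -> nat).

Definition midx := {dffun forall n : 'I_M, 'I_(D n)}.
Definition tensor := midx -> R.

Definition tnorm (A : tensor) : R := Num.sqrt (\sum_(i : midx) A i ^+ 2).

Definition rdim (J : {set 'I_M}) (n : 'I_M) : nat := if n \in J then D n else 1.
Definition cdim (J : {set 'I_M}) (n : 'I_M) : nat := if n \in J then 1 else D n.
Definition ridx (J : {set 'I_M}) := {dffun forall n : 'I_M, 'I_(rdim J n)}.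
Definition cidx (J : {set 'I_M}) := {dffun forall n : 'I_M, 'I_(cdim J n)}.

Definition glue (J : {set 'I_M}) (r : ridx J) (c : cidx J) : midx :=
  [ffun n : 'I_M =>
     (match n \in J as b
        return 'I_(if b then D n else 1) -> 'I_(if b then 1 else D n) -> 'I_(D n)
      with true => fun x _ => x | false => fun _ y => y end) (r n) (c n)].

Definition matricize (A : tensor) (J : {set 'I_M}) :
  'M[R]_(#|{: ridx J}|, #|{: cidx J}|) :=
  \matrix_(i, j) A (glue (enum_val i) (enum_val j)).

Definition QE (A : tensor) (J : {set 'I_M}) : R := QE_mx (matricize A J).

Definition DJ (J : {set 'I_M}) : nat :=
  minn (\prod_(n in J) D n) (\prod_(n in ~: J) D n).

Definition min_dim : nat := \big[minn/(\max_(n : 'I_M) D n)]_(n : 'I_M) D n.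

End Tensors.

(* Nodes at level l (0 = leaves, L = root) are numbered n = 0,1,...;
   the children of node n at level l are nodes 2^P n + k (k < 2^P) at level l-1.
   A tensor phi^{(l,n)}_r is represented as a function of the full multi-index
   depending only on the axes in its block; tensor products of such tensors
   with disjoint (contiguous, consecutive) blocks are pointwise products. *)
Section TN.
Variables (R : realType) (P L Rw : nat) (D : 'I_((2 ^ L) ^ P) -> nat).

Fixpoint tn_phi
  (v : forall n : 'I_((2 ^ L) ^ P), 'I_Rw -> 'I_(D n) -> R)
  (a : nat -> nat -> 'I_Rw -> {ffun 'I_(2 ^ P) -> 'I_Rw} -> R)
  (l n : nat) (r : 'I_Rw) (i : midx D) : R :=
  match l with
  | 0 => match insub n with Some n' => v n' r (i n') | None => 0 end
  | l'.+1 => \sum_(ks : {ffun 'I_(2 ^ P) -> 'I_Rw})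
              a l n r ks * \prod_(k < 2 ^ P) tn_phi v a l' (2 ^ P * n + k) (ks k) i
  end.

Definition tn_tensor
  (v : forall n : 'I_((2 ^ L) ^ P), 'I_Rw -> 'I_(D n) -> R)
  (a : nat -> nat -> 'I_Rw -> {ffun 'I_(2 ^ P) -> 'I_Rw} -> R)
  (atop : {ffun 'I_(2 ^ P) -> 'I_Rw} -> R) : tensor R D :=
  fun i => \sum_(ks : {ffun 'I_(2 ^ P) -> 'I_Rw})
             atop ks * \prod_(k < 2 ^ P) tn_phi v a L.-1 k (ks k) i.

Definition generated_by_LCTN (W : tensor R D) : Prop :=
  exists v a atop, forall i, W i = tn_tensor v a atop i.

Definition compatible (mu : {ffun 'I_P -> 'I_(2 ^ L)} -> 'I_((2 ^ L) ^ P)) : Prop :=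
  bijective mu /\
  forall (l n : nat), (l <= L)%N -> (n < 2 ^ (P * (L - l)))%N ->
    exists (s : nat) (k : 'I_P -> nat),
      [set x : {ffun 'I_P -> 'I_(2 ^ L)} | (2 ^ (P * l) * n <= val (mu x) < 2 ^ (P * l) * n.+1)%N]
      = [set x : {ffun 'I_P -> 'I_(2 ^ L)} | [forall p, (s * k p <= val (x p) < s * (k p).+1)%N]].

Definition canon_block (l : nat) (np : 'I_P -> nat) : {set {ffun 'I_P -> 'I_(2 ^ L)}} :=
  [set x : {ffun 'I_P -> 'I_(2 ^ L)} | [forall p, (2 ^ (L - l) * np p <= val (x p) < 2 ^ (L - l) * (np p).+1)%N]].

Definition is_canonical (K : {set {ffun 'I_P -> 'I_(2 ^ L)}}) : Prop :=
  exists (l : nat) (np : 'I_P -> nat),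
    (l <= L)%N /\ (forall p, (np p < 2 ^ l)%N) /\ K = canon_block l np.

End TN.

(* Main.v *)
(* Upper bound.  A canonical block is sent by mu to the axes below one node of
   the tree; expanding the network along the path from the root to that node
   writes W as a sum of Rw products (tensor on the block) x (tensor off the
   block), so its matricization has rank at most Rw.  If A is within eps of W,
   the projection onto the row space of W captures all but (eps/|A|)^2 of the
   normalized spectrum of A, and Gibbs' inequality against a mixture of the
   captured part with the uniform distribution bounds the entropy.

   Lower bound.  Pair the axis m with its mirror image M - 1 - m, and let A' be
   the indicator of the multi-indices whose paired entries agree and are smaller
   than d = min D_n.  The mirror image of a proper block of the tree is a
   different block, so all axes of the block are paired with axes outside of it
   and every normalized squared singular value is at most d ^ - |block|. *)
Require Import Defs.
From HB Require Import structures.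
From mathcomp Require Import all_boot all_order all_algebra.
From mathcomp Require Import all_classical all_reals all_analysis.
From mathcomp Require Import complex ring lra zify.
Set Implicit Arguments.
Unset Strict Implicit.
Unset Printing Implicit Defensive.
Import Order.TTheory GRing.Theory Num.Theory.
Local Open Scope ring_scope.

(** * Spectra of Gram matrices *)

Section GramSpectrum.
Local Open Scope sesquilinear_scope.
Variable C : numClosedFieldType.

Lemma gram_diagE m n (X : 'M[C]_(m, n)) i :
  (X *m X^t*) i i = \sum_j `|X i j| ^+ 2.
Proof. by rewrite !mxE; apply: eq_bigr => j _; rewrite !mxE normCK. Qed.

Lemma gram_diag_ge0 m n (X : 'M[C]_(m, n)) i : 0 <= (X *m X^t*) i i.
Proof. by rewrite gram_diagE sumr_ge0 // => j _; rewrite exprn_ge0. Qed.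

Lemma trmxC_mul m n p (X : 'M[C]_(m, n)) (Y : 'M[C]_(n, p)) :
  (X *m Y)^t* = Y^t* *m X^t*.
Proof. by rewrite trmx_mul map_mxM. Qed.

Lemma gram_spectral m n (X : 'M[C]_(m, n)) :
  exists P : 'M[C]_n, exists d : 'rV[C]_n,
    [/\ P \is unitarymx, X^t* *m X = P^t* *m diag_mx d *m P
      & forall i, 0 <= d 0 i].
Proof.
pose G := X^t* *m X.
have Gn : G \is normalmx.
  by apply/normalmxP; rewrite /G trmxC_mul trmxCK.
have Pu := spectral_unitarymx G.
have /orthomx_spectralP := Gn; rewrite invmx_unitary // => GE.
exists (spectralmx G), (spectral_diag G); split=> // i.
(* Each eigenvalue is a diagonal entry of the Gram matrix of [spectralmx G *m X^t*]. *)
have : 0 <= ((spectralmx G *m X^t*) *m (spectralmx G *m X^t*)^t*) i i.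
  exact: gram_diag_ge0.
rewrite trmxC_mul trmxCK mulmxA -(mulmxA _ (X^t*)) -/G {2}GE.
rewrite !mulmxA (unitarymxP Pu) mul1mx -mulmxA (unitarymxP Pu) mulmx1.
by rewrite mxE eqxx mulr1n.
Qed.

(** With [Q] the orthogonal projector onto the row space of [Y] and E = 1 - Q, [w i] is the squared
    length of the projection of the [i]-th eigenvector (a row of [P]). The weights add up to the
    trace of [Q], and the last sum is |X E|^2 = |(X - Y) E|^2, as [E] kills [Y]. *)
Lemma low_rank_weights m n (X Y : 'M[C]_(m, n)) (P : 'M[C]_n) (d : 'rV[C]_n) :
  P \is unitarymx -> X^t* *m X = P^t* *m diag_mx d *m P ->
  exists w : 'I_n -> C,
    [/\ forall i, 0 <= w i <= 1, \sum_i w i = (\rank Y)%:R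
      & \sum_i d 0 i * (1 - w i) <= \sum_i \sum_j `|X i j - Y i j| ^+ 2].
Proof.
move=> Pu GE; pose S := schmidt (row_base Y).
have Su : S \is unitarymx by apply: schmidt_unitarymx; apply: rank_leq_col.
have SS : S *m S^t* = 1%:M by apply/unitarymxP.
pose Q := S^t* *m S; pose E := 1%:M - Q.
have YQ : Y *m Q = Y.
  have /submxP[Z ->] : (Y <= S)%MS.
    by rewrite -(eq_row_base Y) schmidt_sub.
  by rewrite /Q mulmxA -(mulmxA Z) SS mulmx1.
have YE : Y *m E = 0 by rewrite mulmxBr mulmx1 YQ subrr.
have QQ : Q *m Q = Q by rewrite /Q mulmxA -(mulmxA (S^t*)) SS mulmx1.
have EE : E *m E = E.
  by rewrite {2}/E mulmxBr mulmx1 /E mulmxBl mul1mx QQ subrr subr0.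
have QH : Q^t* = Q by rewrite trmxC_mul trmxCK.
have EH : E^t* = E.
  by rewrite /E linearB /= map_mxB trmx1 map_mx1 QH.
pose T := P *m S^t*.
have TE : T *m T^t* = P *m Q *m P^t* by rewrite trmxC_mul trmxCK !mulmxA.
pose w i := (T *m T^t*) i i.
have wE i : 1 - w i = (P *m E *m P^t*) i i.
  by rewrite /w TE /E mulmxBr mulmx1 mulmxBl (unitarymxP Pu) !mxE eqxx mulr1n.
exists w; split.
- move=> i; rewrite gram_diag_ge0 -subr_ge0 wE -EE mulmxA.
  by rewrite -{2}EH -mulmxA -trmxC_mul gram_diag_ge0.
- rewrite -/(\tr _) mxtrace_mulC trmxC_mul trmxCK mulmxA -(mulmxA S).
  have -> : P^t* *m P = 1%:M by apply: mulmx1C; apply/unitarymxP.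
  by rewrite mulmx1 SS mxtrace1.
have -> : \sum_i d 0 i * (1 - w i) = \tr (X *m E *m (X *m E)^t*).
  rewrite trmxC_mul EH mulmxA -(mulmxA X E) EE mxtrace_mulC mulmxA GE.
  rewrite -(mulmxA _ P) -(mulmxA _ (diag_mx d)) mxtrace_mulC -mulmxA.
  by apply: eq_bigr => i _; rewrite wE -mulmxA mul_diag_mx [RHS]mxE.
have -> : \sum_i \sum_j `|X i j - Y i j| ^+ 2 = \tr ((X - Y) *m (X - Y)^t*).
  apply: eq_bigr => i _; rewrite gram_diagE; apply: eq_bigr => j _.
  by rewrite !mxE.
have -> : (X *m E) = (X - Y) *m E by rewrite mulmxBl YE subr0.
(* The difference is the trace of the Gram matrix of [(X - Y) *m S^t*]. *)
rewrite -subr_ge0 -raddfB trmxC_mul EH mulmxA -(mulmxA (X - Y) E E) EE.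
rewrite -mulmxBl -{1}(mulmx1 (X - Y)) -mulmxBr opprB addrCA subrr addr0.
rewrite /Q mulmxA -mulmxA -{2}(trmxCK S) -trmxC_mul.
by apply: sumr_ge0 => i _; apply: gram_diag_ge0.
Qed.

End GramSpectrum.

Lemma char_poly_mulmxr (K : comNzRingType) n (P Q D : 'M[K]_n) :
  Q *m P = 1%:M -> char_poly (Q *m D *m P) = char_poly D.
Proof.
move=> QP; pose g := map_mx (@polyC K).
have gQP : g _ _ Q *m g _ _ P = 1%:M by rewrite -map_mxM QP map_mx1.
rewrite /char_poly.
have -> : char_poly_mx (Q *m D *m P) = g _ _ Q *m char_poly_mx D *m g _ _ P.
  rewrite /char_poly_mx mulmxBr mulmxBl -!map_mxM mul_mx_scalar.
  by rewrite -scalemxAl gQP scalemx1.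
by rewrite !det_mulmx mulrAC -det_mulmx gQP det1 mul1r.
Qed.

Section RealGram.
Local Open Scope sesquilinear_scope.
Variable R : realType.

(** The spectral theorem over [complex R] descends to [R]: eigenvalues and weights are nonnegative,
    hence real, and the embedding is injective and preserves order and rank. The roots are fixed
    before [Y], so one spectrum serves every approximation. *)
Lemma gram_roots m n (X : 'M[R]_(m, n)) :
  exists d : 'I_n -> R,
    [/\ forall i, 0 <= d i,
        char_poly (X^T *m X) = \prod_i ('X - (d i)%:P),
        \sum_i d i = \sum_i \sum_j X i j ^+ 2
      & forall Y : 'M[R]_(m, n), exists w : 'I_n -> R,
        [/\ forall i, 0 <= w i <= 1, \sum_i w i = (\rank Y)%:R
          & \sum_i d i * (1 - w i) <= \sum_i \sum_j (X i j - Y i j) ^+ 2]].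
Proof.
pose f : {rmorphism R -> complex R} := real_complex R.
have fconj (Z : 'M[R]_(m, n)) : (map_mx f Z)^t* = map_mx f Z^T.
  apply/matrixP => i j; rewrite !mxE; exact: conjc_real.
have fnorm x : `|f x| ^+ 2 = f (x ^+ 2).
  by rewrite sqr_normc conjc_real -rmorphM.
have fle x y : (f x <= f y) = (x <= y) by exact: lecR.
have [P [d [Pu GE d0]]] := gram_spectral (map_mx f X).
exists (fun i => complex.Re (d 0 i)).
have dE i : d 0 i = f (complex.Re (d 0 i)) by apply/esym/RRe_real/ger0_real.
have P1 : P^t* *m P = 1%:M by apply: mulmx1C; apply/unitarymxP.
split.
- by move=> i; rewrite -fle -dE.
- apply: (map_poly_inj f); rewrite map_char_poly map_mxM -fconj GE.
  rewrite char_poly_mulmxr // char_poly_trig ?diag_mx_is_trig //.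
  rewrite rmorph_prod; apply: eq_bigr => i _.
  by rewrite mxE eqxx mulr1n [in LHS]dE rmorphB /= map_polyX map_polyC.
- apply: (fmorph_inj f); rewrite !rmorph_sum /=.
  transitivity (\tr (map_mx f X *m (map_mx f X)^t*)).
    rewrite mxtrace_mulC GE mxtrace_mulC mulmxA (unitarymxP Pu) mul1mx.
    by apply: eq_bigr => i _; rewrite mxE eqxx mulr1n [RHS]dE.
  apply: eq_bigr => i _; rewrite rmorph_sum gram_diagE; apply: eq_bigr => j _.
  by rewrite mxE fnorm.
move=> Y; have [w [w01 ws wle]] := low_rank_weights (map_mx f Y) Pu GE.
have wE i : w i = f (complex.Re (w i)).
  by have /andP[w0 _] := w01 i; apply/esym/RRe_real/ger0_real.
exists (fun i => complex.Re (w i)); split.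
- move=> i; have := w01 i; rewrite wE.
  by rewrite -(rmorph0 f) -(rmorph1 f) !fle.
- apply: (fmorph_inj f); rewrite rmorph_sum rmorph_nat -(mxrank_map f) -ws.
  by apply: eq_bigr => i _; rewrite [RHS]wE.
rewrite -fle !rmorph_sum; move: wle; congr (is_true (_ <= _)).
  apply: eq_bigr => i _.
  by rewrite [X in X * _]dE [X in 1 - X]wE rmorphM rmorphB rmorph1.
apply: eq_bigr => i _; rewrite rmorph_sum; apply: eq_bigr => j _.
by rewrite !mxE -rmorphB fnorm.
Qed.
End RealGram.

(** * Entropy bounds for finite distributions *)

Section Entropy.
Variable R : realType.

Lemma ln_le_subr1 (x : R) : 0 < x -> ln x <= x - 1.
Proof.
move=> x0; have -> : ln x = ln (1 + (x - 1)) by congr ln; lra.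
by apply: le_ln1Dx; lra.
Qed.

(** This is ln x <= x - 1 at x = q / p; for p = 0 the left side vanishes. *)
Lemma gibbs_pointwise (p q : R) : 0 <= p -> 0 < q ->
  p * ln q - p * ln p <= q - p.
Proof.
rewrite le_eqVlt => /predU1P[<- q0|p0 q0]; first by rewrite !mul0r; lra.
rewrite -mulrBr -ln_div ?posrE //.
have -> : q - p = p * (q / p - 1) by field; lra.
by rewrite ler_pM2l // ln_le_subr1 // divr_gt0.
Qed.

Lemma entropy_ge (I : finType) (p : I -> R) (q : R) :
  0 < q -> (forall i, 0 <= p i <= q) -> \sum_i p i = 1 ->
  - ln q <= - \sum_i p i * ln (p i).
Proof.
move=> q0 pq p1; rewrite lerN2 -[leRHS]mul1r -p1 mulr_suml.
apply: ler_sum => i _; have /andP[p0 pleq] := pq i.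
move: p0; rewrite le_eqVlt => /predU1P[<-|p0]; first by rewrite !mul0r.
by rewrite ler_pM2l // ler_ln ?posrE.
Qed.

(* Gibbs' inequality against q_i = (1 - t) w_i / r + t (1 - w_i) / k, a
   subprobability which mixes the part of the spectrum captured by r directions
   with the uniform distribution; t = x^2 bounds the mass that is not captured. *)
Lemma entropy_le (k : nat) (p w : 'I_k -> R) (r x : R) :
  (forall i, 0 <= p i) -> \sum_i p i = 1 -> (forall i, 0 <= w i <= 1) ->
  1 <= r -> \sum_i w i <= r -> 0 < x -> x <= 4^-1 ->
  \sum_i p i * (1 - w i) <= x ^+ 2 ->
  - \sum_i p i * ln (p i) <= ln r + x ^+ 2 * ln k%:R + 2 * x.
Proof.
move=> p0 p1 w01 r1 wr x0 x4 dx.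
have k0 : (0 < k)%N.
  rewrite lt0n; apply/eqP => k0; move: p1; rewrite big1.
    by move/eqP; rewrite eq_sym oner_eq0.
  by case=> i lti; exfalso; move: lti; rewrite k0.
have k0R : (0 : R) < k%:R by rewrite ltr0n.
have k1R : (1 : R) <= k%:R by rewrite ler1n.
pose t := x ^+ 2; have t0 : 0 < t by rewrite exprn_gt0.
have t16 : t <= 16^-1 by rewrite /t; nra.
pose a := (1 - t) / r; pose b := t / k%:R.
have a0 : 0 < a by rewrite divr_gt0; lra.
have b0 : 0 < b by rewrite divr_gt0.
pose dl := \sum_i p i * (1 - w i).
have dl0 : 0 <= dl.
  by apply: sumr_ge0 => i _; apply: mulr_ge0 => //; have := w01 i; lra.
have pw : \sum_i p i * w i = 1 - dl.
  by rewrite -p1 /dl -sumrB; apply: eq_bigr => i _; ring.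
have qsum : \sum_i (w i * a + (1 - w i) * b - p i) <= 0.
  rewrite sumrB p1 subr_le0 big_split /= -!mulr_suml sumrB sumr_const card_ord.
  rewrite -[leRHS](_ : r * a + k%:R * b = 1); last by rewrite /a /b; field; lra.
  apply: lerD; first by rewrite ler_pM2r.
  rewrite ler_pM2r // lerBlDr lerDl; apply: sumr_ge0 => i _.
  by have /andP[] := w01 i.
(* Gibbs is used against [a] with weight [w i] and against [b] with weight [1 - w i], so the
   logarithm of the mixture never appears. *)
have key : (1 - dl) * ln a + dl * ln b - \sum_i p i * ln (p i) <= 0.
  apply: le_trans qsum; rewrite -pw /dl !mulr_suml -big_split /= -sumrB.
  apply: ler_sum => i _; have /andP[w0 w1] := w01 i.
  have := gibbs_pointwise (p0 i) a0; have := gibbs_pointwise (p0 i) b0.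
  set u := ln a; set v := ln b; set z := ln (p i) => Hb Ha.
  have := ler_wpM2l w0 Ha.
  have w1' : 0 <= 1 - w i by lra.
  by have := ler_wpM2l w1' Hb; lra.
have lnr : 0 <= ln r by apply: ln_ge0.
have lnk : 0 <= ln (k%:R : R) by apply: ln_ge0.
have t1 : 0 < 1 - t by lra.
have lna : ln a = ln (1 - t) - ln r by rewrite ln_div ?posrE //; lra.
have lnb : ln b = ln t - ln k%:R by rewrite ln_div ?posrE.
(* As t <= 1/16, -ln (1 - t) <= t / (1 - t) <= 16/15 t; the term -2 t in [l2] absorbs this at the
   end. *)
have l1 : - ln (1 - t) <= 16 / 15 * t.
  rewrite -lnV ?posrE //; apply: le_trans (ln_le_subr1 _) _.
    by rewrite invr_gt0.
  have -> : (1 - t)^-1 - 1 = t * (1 - t)^-1 by field; lra.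
  rewrite mulrC ler_pM2r // invf_ple ?posrE //; lra.
have l2 : - (t * ln t) <= 2 * x - 2 * t.
  rewrite /t lnXn // -mulrN.
  have -> : - (ln x *+ 2) = ln x^-1 *+ 2 by rewrite lnV ?posrE // mulNrn.
  have -> : 2 * x - 2 * x ^+ 2 = x ^+ 2 * ((x^-1 - 1) *+ 2) by field; lra.
  rewrite ler_pM2l // lerMn2r /= ln_le_subr1 // invr_gt0 //.
have lnt : ln t <= 0 by apply: ln_le0; lra.
have ln1t : ln (1 - t) <= 0 by apply: ln_le0; lra.
rewrite -/t -/dl in dx *.
move: key; rewrite lna lnb; nra.
Qed.

(** [eigvals] comes from choice and is known only through its linear factors; uniqueness of the
    factorization makes it a permutation of the values of [d]. *)
Lemma big_eigvals k (G : 'M[R]_k) (d : 'I_k -> R) (F : R -> R) :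
  char_poly G = \prod_i ('X - (d i)%:P) ->
  \sum_(x <- eigvals G) F x = \sum_i F (d i).
Proof.
move=> Gd; have [_ Ge] : size (eigvals G) = k /\
    char_poly G = \prod_(x <- eigvals G) ('X - x%:P).
  apply: (@xgetPex _ [::] (fun s : seq R =>
    size s = k /\ char_poly G = \prod_(x <- s) ('X - x%:P))).
  exists [seq d i | i <- enum 'I_k].
  by rewrite size_map size_enum_ord Gd big_map big_enum.
have : perm_eq (eigvals G) [seq d i | i <- enum 'I_k].
  by apply: prod_XsubC_eq; rewrite -Ge Gd big_map big_enum.
by move/(perm_big _) ->; rewrite big_map big_enum.
Qed.

Definition mxnorm2 m n (M : 'M[R]_(m, n)) : R := \sum_i \sum_j M i j ^+ 2.

Lemma mxnorm2_tr m n (M : 'M[R]_(m, n)) : mxnorm2 M^T = mxnorm2 M.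
Proof.
rewrite /mxnorm2 exchange_big /=; apply: eq_bigr => i _.
by apply: eq_bigr => j _; rewrite mxE.
Qed.

Lemma mxnorm2_gt0 m n (M : 'M[R]_(m, n)) : M != 0 -> 0 < mxnorm2 M.
Proof.
move=> M0; rewrite lt0r sumr_ge0 ?andbT; last first.
  by move=> i _; apply: sumr_ge0 => j _; apply: sqr_ge0.
apply: contra_neq M0 => M0; apply/matrixP => i j; rewrite mxE.
have /psumr_eq0P/(_ i isT) := M0.
move=> /(_ (fun i _ => sumr_ge0 _ (fun j _ => sqr_ge0 _))).
by move=> /psumr_eq0P/(_ j isT)/eqP; rewrite sqrf_eq0 => /(_ (fun j _ => sqr_ge0 _))/eqP.
Qed.

End Entropy.

(** * Entropy of the singular values of a matrix *)

Section QEmx.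
Variable R : realType.

(** The map v -> v M^T carries eigenvectors over; the image is nonzero because v M^T M = a v is. *)
Lemma eigenvalue_gram_tr m n (M : 'M[R]_(m, n)) a :
  a != 0 -> eigenvalue (M^T *m M) a -> eigenvalue (M *m M^T) a.
Proof.
move=> a0 /eigenvalueP[v vM v0]; apply/eigenvalueP; exists (v *m M^T).
  by rewrite !mulmxA -(mulmxA v) vM scalemxAl.
apply: contra_neq v0 => vMt; apply/eqP; move/eqP: vM.
by rewrite mulmxA vMt mul0mx eq_sym scaler_eq0 (negPf a0).
Qed.

(** This hides which Gram matrix [singular_values] picks. It is the smaller one, so there are
    [minn m n] roots, the source of the dimension in the upper bound. *)
Lemma QE_mx_spectrum m n (M : 'M[R]_(m, n)) : M != 0 ->
  exists d : 'I_(minn m n) -> R,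
    [/\ forall i, 0 <= d i, \sum_i d i = mxnorm2 M,
        QE_mx M = - \sum_i (d i / mxnorm2 M) * ln (d i / mxnorm2 M),
        forall i, d i != 0 -> eigenvalue (M *m M^T) (d i)
      & forall Y : 'M[R]_(m, n), exists w : 'I_(minn m n) -> R,
        [/\ forall i, 0 <= w i <= 1, \sum_i w i = (\rank Y)%:R
          & \sum_i d i * (1 - w i) <= mxnorm2 (M - Y)]].
Proof.
have QEE k (G : 'M[R]_k) (d : 'I_k -> R) (s := map Num.sqrt (eigvals G)) T :
    (forall i, 0 <= d i) -> char_poly G = \prod_i ('X - (d i)%:P) ->
    \sum_i d i = T ->
    - (\sum_(x <- s) x ^+ 2 / (\sum_(x <- s) x ^+ 2) *
        ln (x ^+ 2 / (\sum_(x <- s) x ^+ 2)))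
    = - \sum_i (d i / T) * ln (d i / T).
  move=> d0 Gd dT; have -> : \sum_(x <- s) x ^+ 2 = T.
    rewrite big_map (big_eigvals _ Gd) -dT; apply: eq_bigr => i _.
    by rewrite sqr_sqrtr.
  rewrite big_map (big_eigvals (fun x => Num.sqrt x ^+ 2 / T *
    ln (Num.sqrt x ^+ 2 / T)) Gd); congr (- _).
  by apply: eq_bigr => i _; rewrite sqr_sqrtr.
have eigE k (G : 'M[R]_k) (d : 'I_k -> R) i :
    char_poly G = \prod_i ('X - (d i)%:P) -> eigenvalue G (d i).
  move=> Gd; rewrite eigenvalue_root_char Gd (bigD1 i) //= rootM.
  by rewrite root_XsubC eqxx.
move=> M0; rewrite /QE_mx (negPf M0) /singular_values; case: ifP => mn.
  rewrite (minn_idPl mn); have [d [d0]] := gram_roots M^T.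
  rewrite trmxK => Gd; rewrite -/(mxnorm2 M^T) mxnorm2_tr => dM dw.
  exists d; split=> // [|i _|Y]; [exact: QEE|exact: eigE|].
  have [w [w01 wr wle]] := dw Y^T; exists w; split=> //.
    by rewrite wr mxrank_tr.
  apply: le_trans wle _; rewrite -mxnorm2_tr; apply: ler_sum => i _.
  by apply: ler_sum => j _; rewrite !mxE.
have nm : (n <= m)%N by rewrite ltnW // ltnNge mn.
rewrite (minn_idPr nm); have [d [d0 Gd]] := gram_roots M.
rewrite -/(mxnorm2 M) => dM dw.
exists d; split=> // [|i di0|Y]; first exact: QEE.
  by apply: eigenvalue_gram_tr => //; apply: eigE.
have [w [w01 wr wle]] := dw Y; exists w; split=> //.
apply: le_trans wle _; apply: ler_sum => i _.
by apply: ler_sum => j _; rewrite !mxE.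
Qed.

Lemma QE_mx_ge m n (M : 'M[R]_(m, n)) (q : R) : M != 0 -> 0 < q ->
  (forall a, a != 0 -> eigenvalue (M *m M^T) a -> a <= q * mxnorm2 M) ->
  - ln q <= QE_mx M.
Proof.
move=> M0 q0 qM; have [d [d0 dM -> deig _]] := QE_mx_spectrum M0.
have N0 := mxnorm2_gt0 M0.
apply: entropy_ge => //; last by rewrite -mulr_suml dM divff // gt_eqF.
move=> i; rewrite divr_ge0 ?(ltW N0) //= ler_pdivrMr //.
have [->|di0] := eqVneq (d i) 0; first by rewrite mulr_ge0 ?ltW.
by apply: qM => //; apply: deig.
Qed.

Lemma QE_mx_le_aux m n (M Y : 'M[R]_(m, n)) (r : nat) (x : R) : M != 0 ->
  (\rank Y <= r)%N -> (0 < r)%N -> 0 < x -> x <= 4^-1 ->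
  mxnorm2 (M - Y) <= x ^+ 2 * mxnorm2 M ->
  QE_mx M <= ln r%:R + x ^+ 2 * ln (minn m n)%:R + 2 * x.
Proof.
move=> M0 rY r0 x0 x4 MY; have [d [d0 dM -> _ dw]] := QE_mx_spectrum M0.
have N0 := mxnorm2_gt0 M0.
have [w [w01 wr wle]] := dw Y.
apply: (entropy_le (w := w)) => // [i||||].
- by rewrite divr_ge0 // ltW.
- by rewrite -mulr_suml dM divff // gt_eqF.
- by rewrite ler1n.
- by rewrite wr ler_nat.
rewrite (_ : \sum_i _ = (\sum_i d i * (1 - w i)) / mxnorm2 M).
  by rewrite ler_pdivrMr //; apply: le_trans MY.
by rewrite mulr_suml; apply: eq_bigr => i _; rewrite mulrAC.
Qed.

(** For y > 0 take x = y in the previous bound: y <= 1/4 gives y^2 <= 2 y and y <= sqrt (2 y). For y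
    = 0 let x tend to 0, since that bound asks for x > 0. *)
Lemma QE_mx_le m n (M Y : 'M[R]_(m, n)) (r : nat) (y : R) : M != 0 ->
  (\rank Y <= r)%N -> (0 < r)%N -> 0 <= y -> y <= 4^-1 ->
  mxnorm2 (M - Y) <= y ^+ 2 * mxnorm2 M ->
  QE_mx M <= ln r%:R + 2 * y * ln (minn m n)%:R + 2 * Num.sqrt (2 * y).
Proof.
move=> M0 rY r0 y0 y4 MY.
set k := ln (minn m n)%:R; have k0 : 0 <= k.
  have [mn0|mn0] := posnP (minn m n); first by rewrite /k mn0 ln0.
  by apply: ln_ge0; rewrite ler1n.
move: y0; rewrite le_eqVlt => /predU1P[y0|y0]; last first.
  have := QE_mx_le_aux M0 rY r0 y0 y4 MY; rewrite -/k.
  have : y <= Num.sqrt (2 * y).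
    by rewrite -{1}(ger0_norm (ltW y0)) -sqrtr_sqr ler_sqrt; nra.
  have : y ^+ 2 * k <= 2 * y * k by apply: ler_wpM2r => //; nra.
  lra.
rewrite -y0 mulr0 mul0r sqrtr0 mulr0 !addr0; apply/ler_addgt0Pr => e e0.
(* Chosen so that x^2 k + 2 x <= x (k + 2) <= e. *)
pose x := Num.min 4^-1 (e / (k + 2)).
have x0 : 0 < x by rewrite lt_min; apply/andP; split; [lra|rewrite divr_gt0; lra].
have x4 : x <= 4^-1 by rewrite ge_min lexx.
have xe : x * (k + 2) <= e.
  by rewrite -ler_pdivlMr; [rewrite ge_min lexx orbT|lra].
have MY' : mxnorm2 (M - Y) <= x ^+ 2 * mxnorm2 M.
  apply: le_trans MY _; rewrite -y0 expr0n mul0r.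
  by rewrite mulr_ge0 ?sqr_ge0 // ltW // mxnorm2_gt0.
have := QE_mx_le_aux M0 rY r0 x0 x4 MY'; rewrite -/k.
have : x ^+ 2 * k <= x * k by apply: ler_wpM2r => //; nra.
lra.
Qed.
End QEmx.

(** * Matricization *)

Section Matricize.
Variables (R : realType) (M : nat) (D : 'I_M -> nat) (J : {set 'I_M}).

(** Row component of the inverse of [glue]. The branch on [n \in J] is annotated because the type of
    the entry depends on it; axes outside [J] carry the only element of ['I_1]. *)
Definition rpart (i : midx D) : ridx D J :=
  [ffun n => (if n \in J as b return 'I_(D n) -> 'I_(if b then D n else 1)
              then id else fun=> ord0) (i n)].

Definition cpart (i : midx D) : cidx D J :=
  [ffun n => (if n \in J as b return 'I_(D n) -> 'I_(if b then 1 else D n)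
              then fun=> ord0 else id) (i n)].

Lemma glueK (i : midx D) : Defs.glue (rpart i) (cpart i) = i.
Proof. by apply/ffunP => n; rewrite !ffunE; case: (n \in J). Qed.

Lemma rpart_glue (r : ridx D J) (c : cidx D J) : rpart (Defs.glue r c) = r.
Proof.
apply/ffunP => n; rewrite !ffunE; move: (r n) (c n); rewrite /rdim /cdim.
by case: (n \in J) => // x y; rewrite !ord1.
Qed.

Lemma cpart_glue (r : ridx D J) (c : cidx D J) : cpart (Defs.glue r c) = c.
Proof.
apply/ffunP => n; rewrite !ffunE; move: (r n) (c n); rewrite /rdim /cdim.
by case: (n \in J) => // x y; rewrite !ord1.
Qed.

Lemma eq_rpart (i j : midx D) : {in J, forall n, i n = j n} -> rpart i = rpart j.
Proof.
move=> ij; apply/ffunP => n; rewrite !ffunE /rdim.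
move: (i n) (j n) (ij n); case: (n \in J) => [x y -> //|x y _] //.
Qed.

Lemma glue_in (r : ridx D J) (c c' : cidx D J) n :
  n \in J -> Defs.glue r c n = Defs.glue r c' n :> 'I_(D n).
Proof.
rewrite !ffunE; move: (r n) (c n) (c' n); rewrite /rdim /cdim.
by case: (n \in J).
Qed.

Lemma glue_out (r r' : ridx D J) (c : cidx D J) n :
  n \notin J -> Defs.glue r c n = Defs.glue r' c n :> 'I_(D n).
Proof.
rewrite !ffunE; move: (r n) (r' n) (c n); rewrite /rdim /cdim.
by case: (n \in J).
Qed.

Lemma sum_glue (F : midx D -> R) :
  \sum_i F i = \sum_(r : ridx D J) \sum_(c : cidx D J) F (Defs.glue r c).
Proof.
rewrite pair_big /= (reindex (fun p : ridx D J * cidx D J => Defs.glue p.1 p.2)) //.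
exists (fun i => (rpart i, cpart i)) => [[r c]|i] _ /=.
  by rewrite rpart_glue cpart_glue.
exact: glueK.
Qed.

Lemma card_dffun n (E : 'I_n -> nat) :
  #|{dffun forall i : 'I_n, 'I_(E i)}| = (\prod_i E i)%N.
Proof.
rewrite card_dep_ffun foldrE big_map big_enum /=.
by apply: eq_bigr => i _; rewrite card_ord.
Qed.

Lemma card_ridx : #|{: ridx D J}| = (\prod_(n in J) D n)%N.
Proof. by rewrite card_dffun [RHS]big_mkcond; apply: eq_bigr. Qed.

Lemma card_cidx : #|{: cidx D J}| = (\prod_(n in ~: J) D n)%N.
Proof.
rewrite card_dffun [RHS]big_mkcond; apply: eq_bigr => n _.
by rewrite inE /cdim; case: (n \in J).
Qed.

Lemma mxnorm2_matricize (A : tensor R D) : mxnorm2 (matricize A J) = tnorm A ^+ 2.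
Proof.
rewrite /tnorm sqr_sqrtr; last by apply: sumr_ge0 => i _; apply: sqr_ge0.
rewrite sum_glue [RHS]big_enum_val; apply: eq_bigr => i _.
by rewrite [RHS]big_enum_val; apply: eq_bigr => j _; rewrite mxE.
Qed.

Lemma matricizeB (A B : tensor R D) :
  matricize A J - matricize B J = matricize (fun i => A i - B i) J.
Proof. by apply/matrixP => i j; rewrite !mxE. Qed.

Lemma matricize_eq0 (A : tensor R D) : (matricize A J == 0) = (tnorm A == 0).
Proof.
rewrite -[RHS]sqrf_eq0 -mxnorm2_matricize; have [->|A0] := eqVneq.
  by rewrite /mxnorm2 big1 ?eqxx // => i _; rewrite big1 // => j _; rewrite mxE expr0n.
by rewrite gt_eqF // mxnorm2_gt0.
Qed.

End Matricize.

(** * Separated sums, rank and entropy *)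

Section Rank.
Variables (R : realType) (M : nat) (D : 'I_M -> nat).

(** Network tensors are functions of the full multi-index, so living on the axes [S] means ignoring
    all other entries. *)
Definition depends_on (S : pred 'I_M) (f : tensor R D) :=
  forall i j : midx D, (forall n, S n -> i n = j n) -> f i = f j.

(** The sum factors the matricization through dimension [r]: the [f q] give the columns of one
    factor, the [g q] the rows of the other. *)
Lemma rank_matricize (J : {set 'I_M}) r (W : tensor R D)
    (f g : 'I_r -> tensor R D) :
  (forall q, depends_on (mem J) (f q)) ->
  (forall q, depends_on [predC J] (g q)) ->
  (forall i, W i = \sum_q f q i * g q i) ->
  (\rank (matricize W J) <= r)%N.
Proof.
(* [i0] fills the axes that a factor ignores; without any multi-index the matrix has no entries. *)
move=> fJ gJ WE; have [i0 _|noi] := pickP (mem {: midx D}); last first.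
  suff -> : matricize W J = 0 by rewrite mxrank0.
  apply/matrixP => i j; exfalso.
  by have := noi (Defs.glue (enum_val i) (enum_val j)).
pose X : 'M[R]_(#|{: ridx D J}|, r) := \matrix_(i, q)
  f q (Defs.glue (enum_val i) (cpart J i0)).
pose Y : 'M[R]_(r, #|{: cidx D J}|) := \matrix_(q, j)
  g q (Defs.glue (rpart J i0) (enum_val j)).
suff -> : matricize W J = X *m Y.
  by apply: leq_trans (mxrankM_maxl _ _) (rank_leq_col _).
apply/matrixP => i j; rewrite !mxE WE; apply: eq_bigr => q _; rewrite !mxE.
congr (_ * _).
  by apply: fJ => n nJ; apply: glue_in.
by apply: gJ => n nJ; apply: glue_out.
Qed.

Lemma QE_le (J : {set 'I_M}) (W A : tensor R D) (r : nat) (eps : R) :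
  (\rank (matricize W J) <= r)%N -> (0 < r)%N ->
  0 <= eps -> eps <= tnorm A / 4 -> tnorm (fun i => W i - A i) <= eps ->
  QE A J <= ln r%:R + (2 * eps / tnorm A) * ln (DJ D J)%:R
    + 2 * Num.sqrt (2 * eps / tnorm A).
Proof.
move=> rW r0 e0 eA WA; have lnr : 0 <= ln (r%:R : R) by apply: ln_ge0; rewrite ler1n.
(* For A = 0 the quotient by the norm is 0, as in the convention for eps / |A|, and the bound reads
   0 <= ln r. *)
have [A0|A0] := eqVneq (matricize A J) 0.
  have /eqP -> : tnorm A == 0 by rewrite -(matricize_eq0 J) A0.
  by rewrite /QE /QE_mx A0 eqxx invr0 mulr0 mul0r sqrtr0 mulr0 !addr0.
have tA : 0 < tnorm A.
  by rewrite lt0r sqrtr_ge0 andbT -(matricize_eq0 J).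
rewrite /DJ -card_ridx -card_cidx -(mulrA 2 eps (tnorm A)^-1).
apply: (@QE_mx_le _ _ _ _ (matricize W J)) => //.
- by rewrite divr_ge0 // ltW.
- by rewrite ler_pdivrMr // mulrC.
rewrite matricizeB !mxnorm2_matricize -exprMn divfK ?gt_eqF //.
rewrite lerXn2r ?nnegrE ?sqrtr_ge0 //; apply: le_trans WA.
rewrite /tnorm; under eq_bigr do rewrite -sqrrN opprB.
exact: lexx.
Qed.
End Rank.

(** * Rank of the network *)

Section Network.
Variables (R : realType) (P L Rw : nat) (D : 'I_((2 ^ L) ^ P) -> nat).

(** Numbering starts at 0, so blocks are fibres of a quotient and the parent of [n] is
    [n %/ 2 ^ P]. *)
Definition node_axes (l n : nat) : {set 'I_((2 ^ L) ^ P)} :=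
  [set m | (val m %/ 2 ^ (P * l))%N == n].

Lemma node_axes_child l n : node_axes l n \subset node_axes l.+1 (n %/ 2 ^ P).
Proof.
by apply/fintype.subsetP => m; rewrite !inE mulnS addnC expnD divnMA => /eqP ->.
Qed.

Lemma sub_depends_on (S S' : pred 'I_((2 ^ L) ^ P)) (f : tensor R D) :
  subpred S S' -> depends_on S f -> depends_on S' f.
Proof. by move=> SS' fS i j ij; apply: fS => n /SS'; apply: ij. Qed.

Lemma tn_phi_depends_on
    (v : forall n : 'I_((2 ^ L) ^ P), 'I_Rw -> 'I_(D n) -> R) a l n r :
  depends_on (mem (node_axes l n)) (tn_phi v a l n r).
Proof.
elim: l n r => [|l IH] n r i j ij /=.
  case: insubP => // n' _ nE; rewrite ij //= inE muln0 expn0 divn1.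
  exact/eqP.
apply: eq_bigr => ks _; congr (_ * _); apply: eq_bigr => k _.
apply: IH => m /(fintype.subsetP (node_axes_child _ _)); rewrite mulnC divnMDl ?expn_gt0 //.
by rewrite divn_small // addn0; apply: ij.
Qed.

(** Grouping the index tuples by their value at [k0] pulls out the factor of that child; the
    siblings and coefficients form [h]. *)
Lemma branch_split K (c : {ffun 'I_K -> 'I_Rw} -> R)
    (phi : 'I_K -> 'I_Rw -> tensor R D) (S : pred 'I_((2 ^ L) ^ P)) k0 :
  (forall k r, k != k0 -> depends_on S (phi k r)) ->
  exists h : 'I_Rw -> tensor R D,
    (forall r, depends_on S (h r)) /\
    forall i, \sum_ks c ks * \prod_k phi k (ks k) i
              = \sum_r phi k0 r i * h r i.
Proof.
move=> phiS; exists (fun r i => \sum_(ks : {ffun 'I_K -> 'I_Rw} | ks k0 == r)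
  c ks * \prod_(k | k != k0) phi k (ks k) i); split.
  move=> r i j ij; apply: eq_bigr => ks _; congr (_ * _).
  by apply: eq_bigr => k kk0; apply: phiS.
move=> i; rewrite (partition_big (fun ks : {ffun 'I_K -> 'I_Rw} => ks k0) predT) //=.
apply: eq_bigr => r _; rewrite mulr_sumr; apply: eq_bigr => ks /eqP ksr.
by rewrite (bigD1 k0) //= ksr mulrCA.
Qed.

(** Induction on the distance to the children of the root: each step descends to one child and
    absorbs its siblings into the off-block factor, so the number of terms stays [Rw]. *)
Lemma network_split
    (v : forall n : 'I_((2 ^ L) ^ P), 'I_Rw -> 'I_(D n) -> R) a atop l n :
  (l < L)%N -> (n < 2 ^ (P * (L - l)))%N ->
  exists g : 'I_Rw -> tensor R D,
    (forall r, depends_on [predC node_axes l n] (g r)) /\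
    forall i, tn_tensor v a atop i = \sum_r tn_phi v a l n r i * g r i.
Proof.
move=> lL; move jE : (L - l.+1)%N => j; have {lL jE}ljL : (l + j.+1)%N = L by lia.
rewrite -{1}ljL addKn; elim: j l n ljL => [|j IH] l n ljL nj.
  rewrite muln1 in nj.
  have [|h [hS hE]] := @branch_split _ atop (fun k r => tn_phi v a l k r)
    [predC node_axes l n] (Ordinal nj).
    move=> k r kn; apply: sub_depends_on (@tn_phi_depends_on v a l k r).
    move=> m /=; rewrite !inE => /eqP ->; exact: kn.
  exists h; split=> // i; rewrite -hE /tn_tensor.
  by have -> : L.-1 = l by lia.
set n' := (n %/ 2 ^ P)%N; have n'j : (n' < 2 ^ (P * j.+1))%N.
  by rewrite ltn_divLR ?expn_gt0 // -expnD addnC -mulnS.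
have [|g [gS gE]] := IH l.+1 n' _ n'j; first by lia.
have k0P : (n %% 2 ^ P < 2 ^ P)%N by rewrite ltn_mod expn_gt0.
pose k0 := Ordinal k0P.
have nE : (2 ^ P * n' + k0)%N = n by rewrite mulnC -divn_eq.
have split_r r := @branch_split _ (a l.+1 n' r)
  (fun k r => tn_phi v a l (2 ^ P * n' + k) r) [predC node_axes l n] k0.
have /fin_all_exists[h hP] : forall r, exists h : 'I_Rw -> tensor R D,
    (forall r, depends_on [predC node_axes l n] (h r)) /\
    forall i, tn_phi v a l.+1 n' r i = \sum_q tn_phi v a l n q i * h q i.
  move=> r; have [|h [hS hE]] := split_r r; last first.
    by exists h; split=> // i; rewrite /= hE nE.
  move=> k q kk0; apply: sub_depends_on (@tn_phi_depends_on v a l _ q).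
  move=> m /=; rewrite !inE => /eqP ->; rewrite -nE eqn_add2l; exact: kk0.
(* Summing over the parent index [r] inside the factor leaves only the child index [q]. *)
exists (fun q i => \sum_r h r q i * g r i); split.
  move=> q i i' ii'; apply: eq_bigr => r _; congr (_ * _).
    by apply: (hP r).1.
  apply: (sub_depends_on _ (gS r)) ii' => m /=; apply: contra.
  exact: (fintype.subsetP (node_axes_child _ _)).
move=> i; rewrite gE.
under eq_bigr => r _ do rewrite (hP r).2 mulr_suml.
rewrite exchange_big /=; apply: eq_bigr => q _; rewrite mulr_sumr.
by apply: eq_bigr => r _; rewrite mulrA.
Qed.

Lemma rank_LCTN (W : tensor R D) l n : (0 < Rw)%N ->
  @generated_by_LCTN R P L Rw D W -> (l <= L)%N -> (n < 2 ^ (P * (L - l)))%N ->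
  (\rank (matricize W (node_axes l n)) <= Rw)%N.
Proof.
move=> Rw0 [v [a [atop WE]]]; rewrite leq_eqVlt => /predU1P[->|lL] nl.
  (* The root block contains all axes, so the matrix has a single column. *)
  apply: leq_trans Rw0; apply: leq_trans (rank_leq_col _) _.
  have -> : n = 0%N by move: nl; rewrite subnn muln0 expn0; lia.
  rewrite card_cidx big1 // => m; rewrite !inE => /negP[].
  by rewrite divn_small ?eqxx // [(P * L)%N]mulnC expnM ltn_ord.
have [g [gS gE]] := network_split v a atop lL nl.
apply: (@rank_matricize _ _ _ _ _ _ (tn_phi v a l n) g) => [q|q|i].
- exact: tn_phi_depends_on.
- exact: gS.
- by rewrite WE gE.
Qed.

End Network.

(** * Compatible maps *)

Section Cubes.
Local Open Scope nat_scope.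
Variables (P L : nat).

Lemma card_ord_itv N a b : #|[pred j : 'I_N | a <= j < b]| = minn b N - a.
Proof.
rewrite -[RHS]muln1 -sum_nat_const_nat big_geq_mkord.
rewrite (big_ord_widen_cond N (fun j => a <= j) (fun=> 1)) ?geq_minr //.
rewrite -sum1_card; apply: eq_bigl => j /=.
by rewrite !inE ltn_min ltn_ord andbT.
Qed.

Definition cube (s : nat) (k : 'I_P -> nat) : {set {ffun 'I_P -> 'I_(2 ^ L)}} :=
  [set x : {ffun 'I_P -> 'I_(2 ^ L)} |
    [forall p, s * k p <= val (x p) < s * (k p).+1]].

Lemma card_cube s k :
  #|cube s k| = \prod_p (minn (s * (k p).+1) (2 ^ L) - s * k p).
Proof.
pose F p := [pred j : 'I_(2 ^ L) | s * k p <= j < s * (k p).+1].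
transitivity #|family F|.
  rewrite cardsE; apply: eq_card => x.
  by rewrite !inE; apply/forallP/familyP => xF p; have := xF p; rewrite inE.
rewrite card_family foldrE big_map big_enum /=.
by apply: eq_bigr => p _; rewrite -card_ord_itv.
Qed.

(* The cube may be cut off at the boundary of the grid; its side lengths are
   nevertheless powers of 2, which forces them to be equal and aligned. *)
Lemma cube_aligned s k l : 0 < P -> l <= L -> #|cube s k| = 2 ^ (P * l) ->
  exists k', cube s k = cube (2 ^ l) k'.
Proof.
move=> P0 lL; rewrite card_cube => cardE.
pose e p := minn (s * (k p).+1) (2 ^ L) - s * k p.
rewrite -[LHS]/(\prod_p e p) in cardE.
have epow p : exists m, e p = 2 ^ m.
  have : e p %| 2 ^ (P * l) by rewrite -cardE (bigD1 p) //= dvdn_mulr.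
  by case/(dvdn_pfactor _ _ (isT : prime 2)) => m _; exists m.
have e0 p : 0 < e p by have [m ->] := epow p; rewrite expn_gt0.
have eqe c : (forall p, e p = c) -> c = 2 ^ l.
  move=> ec; move: cardE; rewrite (eq_bigr (fun=> c)) // prod_nat_const card_ord.
  by rewrite mulnC expnM => /eqP; rewrite eqn_exp2r // => /eqP.
(* If one side is not cut off, its length is [s], a power of 2 dividing 2^L, so no side is cut
   off. *)
have [/existsP[p sp]|] := boolP [exists p, s * (k p).+1 <= 2 ^ L].
  have [m sm] : exists m, s = 2 ^ m.
    have [m em] := epow p; exists m; rewrite -em /e (minn_idPl sp).
    by rewrite mulnS addnK.
  have mL : m <= L.
    rewrite -(leq_exp2l (m := 2)) // -sm; apply: leq_trans sp.
    by rewrite leq_pmulr.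
  exists k; suff -> : s = 2 ^ l by [].
  apply: eqe => q; rewrite /e; have := e0 q; rewrite {1}/e subn_gt0 leq_min.
  move=> /andP[_]; rewrite -(subnK mL) expnD -sm mulnC.
  move: (2 ^ _) => u; have [->|s0] := posnP s; first by rewrite !muln0.
  rewrite ltn_pmul2r // => ku; rewrite (mulnC u) (minn_idPl _).
    by rewrite mulnS mulnC addnK.
  by rewrite leq_pmul2l.
(* Otherwise every side is cut off: the cube is the far corner of the grid, with aligned index 2^(L
   - l) - 1 in every direction. *)
move=> /existsPn noP.
have big p : 2 ^ L < s * (k p).+1 by rewrite ltnNge noP.
have small p : s * k p < 2 ^ L.
  by have := e0 p; rewrite subn_gt0 leq_min => /andP[].
have s0 : 0 < s by case: (posnP s) => // sz; have := big (Ordinal P0); rewrite sz mul0n.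
have kE p : k p = 2 ^ L %/ s.
  by apply/eqP; rewrite eqn_leq leq_divRL // mulnC ltnW //= -ltnS ltn_divLR // mulnC.
pose q := 2 ^ L %/ s; have bigq : 2 ^ L < s * q.+1.
  by rewrite /q -(kE (Ordinal P0)).
have smallq : s * q < 2 ^ L by rewrite /q -(kE (Ordinal P0)).
have sE : 2 ^ L - s * q = 2 ^ l.
  by apply: eqe => p; rewrite /e kE -/q (minn_idPr (ltnW bigq)).
exists (fun=> 2 ^ (L - l) - 1).
apply/setP => x; rewrite !inE; apply: eq_forallb => p.
have xL := ltn_ord (x p); rewrite kE -/q (ltn_trans xL bigq).
rewrite subn1 prednK ?expn_gt0 // -subn1 mulnBr muln1 -expnD subnKC // xL.
by rewrite -sE subKn // ltnW.
Qed.

Lemma mem_cube s k x : 0 < s -> (x \in cube s k) = [forall p, val (x p) %/ s == k p].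
Proof.
move=> s0; rewrite inE; apply: eq_forallb => p.
by rewrite eqn_leq leq_divRL // -(ltnS _ (k p)) ltn_divLR // andbC !(mulnC _ s).
Qed.

Lemma card_node_axes l n : l <= L -> n < 2 ^ (P * (L - l)) ->
  #|node_axes P L l n| = 2 ^ (P * l).
Proof.
move=> lL nl.
transitivity #|[pred m : 'I_((2 ^ L) ^ P) | 2 ^ (P * l) * n <= m < 2 ^ (P * l) * n.+1]|.
  apply: eq_card => m; rewrite !inE eqn_leq leq_divRL ?expn_gt0 //.
  by rewrite -(ltnS _ n) ltn_divLR ?expn_gt0 // andbC !(mulnC _ (2 ^ (P * l))).
rewrite card_ord_itv (minn_idPl _); first by rewrite mulnS addnK.
rewrite -expnM (mulnC L) -(subnKC lL) mulnDr expnD.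
by rewrite leq_pmul2l ?expn_gt0.
Qed.

(** Take the node whose block has the size of [K] and contains the image of the corner [x0]. Its
    preimage is a cube, aligned by its cardinality, and two aligned cubes of equal side sharing [x0]
    coincide. *)
Lemma compatible_canonical (mu : {ffun 'I_P -> 'I_(2 ^ L)} -> 'I_((2 ^ L) ^ P)) K :
  0 < P -> compatible mu -> is_canonical K ->
  exists l n, [/\ l <= L, n < 2 ^ (P * (L - l)), mu @: K = node_axes P L l n
    & #|K| = 2 ^ (P * l)].
Proof.
move=> P0 [[nu muK nuK] mu_node] [l' [np [l'L [npl KE]]]].
(* Canonical levels count from the whole grid, tree levels from the leaves. *)
have l'l : L - (L - l') = l' by lia.
move: KE; rewrite /canon_block -/(cube _ _); set l := L - l' => KE.
have lL : l <= L by apply: leq_subr.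
have x0P p : 2 ^ l * np p < 2 ^ L.
  by rewrite -(subnKC lL) expnD ltn_pmul2l ?expn_gt0 // l'l.
pose x0 := [ffun p => Ordinal (x0P p)].
pose n := val (mu x0) %/ 2 ^ (P * l).
have nL : n < 2 ^ (P * (L - l)).
  rewrite ltn_divLR ?expn_gt0 // -expnD -mulnDr subnK // mulnC expnM.
  exact: ltn_ord.
have [s [k nodeE]] := mu_node l n lL nL.
have muE : [set x | mu x \in node_axes P L l n] = cube s k.
  rewrite /cube -nodeE; apply/setP => x; rewrite !inE eqn_leq leq_divRL ?expn_gt0 //.
  by rewrite -(ltnS _ n) ltn_divLR ?expn_gt0 // andbC !(mulnC _ (2 ^ (P * l))).
have imE : mu @: [set x | mu x \in node_axes P L l n] = node_axes P L l n.
  apply/setP => m; apply/imsetP/idP => [[x + ->]|mn]; first by rewrite inE.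
  by exists (nu m); [rewrite inE nuK|rewrite nuK].
have card_pre : #|[set x | mu x \in node_axes P L l n]| = 2 ^ (P * l).
  by rewrite -(card_imset _ (can_inj muK)) imE card_node_axes.
have [|k' cubeE] := @cube_aligned s k l P0 lL; first by rewrite -muE.
suff preE : [set x | mu x \in node_axes P L l n] = K.
  by exists l, n; rewrite -preE imE card_pre.
have x0_in : x0 \in cube (2 ^ l) k' by rewrite -cubeE -muE !inE.
have k'E p : k' p = np p.
  move: x0_in; rewrite mem_cube ?expn_gt0 // => /forallP/(_ p)/eqP <-.
  by rewrite ffunE /= mulKn ?expn_gt0.
rewrite muE cubeE KE; apply/setP => x; rewrite !inE.
by apply: eq_forallb => p; rewrite k'E.
Qed.

End Cubes.

(** * A highly entangled tensor *)

(** Case q = 1 of [entropy_ge]; it settles the partition with an empty side. *)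
Lemma QE_mx_ge0 (R : realType) m n (M : 'M[R]_(m, n)) : 0 <= QE_mx M.
Proof.
have [->|M0] := eqVneq M 0; first by rewrite /QE_mx eqxx.
have [d [d0 dM -> _ _]] := QE_mx_spectrum M0; have N0 := mxnorm2_gt0 M0.
rewrite -[leLHS]oppr0 -[X in - X <= _](ln1 R); apply: entropy_ge => //; last first.
  by rewrite -mulr_suml dM divff // gt_eqF.
move=> i; rewrite divr_ge0 ?(ltW N0) //= ler_pdivrMr // mul1r -dM.
by rewrite (bigD1 i) //= lerDl; apply: sumr_ge0.
Qed.

Lemma min_dim_le M (D : 'I_M -> nat) n : (min_dim D <= D n)%N.
Proof.
rewrite /min_dim; move: (\max_n _)%N => x0.
have : n \in index_enum 'I_M by rewrite mem_index_enum.
elim: (index_enum _) => //= m s IH; rewrite inE big_cons geq_min.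
by case/predU1P => [->|/IH ->]; rewrite ?leqnn ?orbT.
Qed.

Lemma min_dim_gt0 M (D : 'I_M -> nat) : (0 < M)%N -> (forall n, 0 < D n)%N ->
  (0 < min_dim D)%N.
Proof.
move=> M0 D0; rewrite /min_dim; elim/big_ind: _ => // [|x y x0 y0].
  exact: leq_trans (D0 (Ordinal M0)) (leq_bigmax _).
by rewrite leq_min x0.
Qed.

Section PairedAxes.
Variables (R : realType) (M : nat) (D : 'I_M -> nat) (sigma : 'I_M -> 'I_M).
Variable (d : nat).
Hypothesis sigmaK : involutive sigma.
Hypothesis dD : forall n, (d.+1 <= D n)%N.

(** Admissible entries are 0, ..., d, so [d.+1] plays the role of the minimal dimension. Entries are
    compared in [nat] because paired axes may have different dimensions. *)
Definition paired (i : midx D) : bool :=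
  [forall n, (i n <= d)%N && (i n == i (sigma n) :> nat)].

Definition paired_tensor : tensor R D := fun i => (paired i)%:R.

Variable J : {set 'I_M}.
Hypothesis sigmaJ : forall n, n \in J -> sigma n \notin J.

(** Overwrites the entries on [J] by [t] and copies them to the mirror axes, so that the pairing
    survives. *)
Definition repaint (t : {ffun 'I_M -> 'I_d.+1}) (i : midx D) : midx D :=
  [ffun n => if n \in J then widen_ord (dD n) (t n)
             else if sigma n \in J then widen_ord (dD n) (t (sigma n))
             else i n].

Lemma repaint_paired t i : paired i -> paired (repaint t i).
Proof.
move/forallP => ip; apply/forallP => n; rewrite !ffunE sigmaK.
have [nJ|nJ] := boolP (n \in J).
  by rewrite (negPf (sigmaJ nJ)) /= -ltnS ltn_ord eqxx.
have [sJ|_] := boolP (sigma n \in J); last exact: ip.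
by rewrite /= -ltnS ltn_ord eqxx.
Qed.

(** Repainting is injective on pairs of a [t] supported on [J] and a paired [i] with row [r]: [t] is
    read off on [J], while [i] is given by [r] on [J], by the pairing on the mirror of [J], and is
    unchanged elsewhere. *)
Lemma card_paired (r : ridx D J) :
  (d.+1 ^ #|J| * #|[set i | paired i && (rpart J i == r)]| <= #|[set i | paired i]|)%N.
Proof.
set S := [set i | paired i && _].
have -> : (d.+1 ^ #|J|)%N = #|[set t in pffun_on (ord0 : 'I_d.+1) J predT]|.
  by rewrite cardsE card_pffun_on card_ord.
rewrite -cardsX -(@card_in_imset _ _ (fun p => repaint p.1 p.2)).
  apply: subset_leq_card; apply/fintype.subsetP => _ /imsetP[[t i] + ->] /=.
  by rewrite !inE /= => /andP[_ /andP[ip _]]; apply: repaint_paired.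
move=> [t i] [t' i']; rewrite !inE /=.
move=> /andP[/pffun_onP[tJ _] /andP[/forallP ip /eqP ir]].
move=> /andP[/pffun_onP[tJ' _] /andP[/forallP ip' /eqP ir']] e.
have iJ n : n \in J -> i n = i' n.
  by move=> nJ; rewrite -(glueK J i) -(glueK J i') ir ir'; apply: glue_in.
congr (_, _); apply/ffunP => n.
  have [nJ|nJ] := boolP (n \in J).
    move/ffunP/(_ n)/(congr1 val): e; rewrite !ffunE nJ /= => /val_inj; exact.
  have out (u : {ffun 'I_M -> 'I_d.+1}) : subpred (ord0.-support u) (mem J) -> u n = ord0.
    by move=> uJ; apply/eqP; apply: contraNT nJ => un; apply: uJ.
  by rewrite !out //; apply/fintype.subsetP.
have [nJ|nJ] := boolP (n \in J); first exact: iJ.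
have [sJ|sJ] := boolP (sigma n \in J); last first.
  by move/ffunP/(_ n): e; rewrite !ffunE (negPf nJ) (negPf sJ).
apply: val_inj => /=; have /andP[_ /eqP ->] := ip n; have /andP[_ /eqP ->] := ip' n.
by rewrite iJ.
Qed.

(** The Gram matrix is diagonal: the mirror axes of [J] lie outside [J], so a column meeting a
    paired multi-index determines its row. *)
Lemma gram_paired (i j : 'I_#|{: ridx D J}|) :
  (matricize paired_tensor J *m (matricize paired_tensor J)^T) i j
  = (if i == j then #|[set k | paired k && (rpart J k == enum_val i)]| else 0%N)%:R.
Proof.
rewrite mxE; under eq_bigr do rewrite !mxE.
case: eqVneq => [<-|ij].
  rewrite -sum1_card natr_sum [RHS]big_mkcond /= [RHS](sum_glue J).
  rewrite [RHS](bigD1 (enum_val i)) //=.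
  rewrite [X in _ = _ + X]big1 ?addr0; last first.
    move=> r ri; apply: big1 => c _.
    by rewrite inE rpart_glue (negPf ri) andbF.
  rewrite [RHS]big_enum_val; apply: eq_bigr => c _.
  rewrite inE rpart_glue eqxx andbT /paired_tensor.
  by case: paired; rewrite /= ?mulr1 ?mulr0.
apply: big1 => c _; rewrite /paired_tensor -natrM mulnb.
have [/andP[/forallP pi /forallP pj]|//] := boolP (_ && _).
case/eqP: ij; apply: enum_val_inj.
rewrite -(rpart_glue (enum_val i) (enum_val c)) -(rpart_glue (enum_val j) (enum_val c)).
apply: eq_rpart => n nJ; apply: val_inj.
have /andP[_ /eqP/= ->] := pi n; have /andP[_ /eqP/= ->] := pj n.
by rewrite (glue_out _ (enum_val j)) ?sigmaJ.
Qed.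

Lemma QE_paired : #|J|%:R * ln (d.+1%:R : R) <= QE paired_tensor J.
Proof.
pose T := matricize paired_tensor J; pose q : R := (d.+1 ^ #|J|)%:R^-1.
have q0 : 0 < q by rewrite invr_gt0 ltr0n expn_gt0.
have TE : mxnorm2 T = #|[set i | paired i]|%:R.
  rewrite mxnorm2_matricize /tnorm sqr_sqrtr; last first.
    by apply: sumr_ge0 => i _; apply: sqr_ge0.
  rewrite -sum1_card natr_sum [RHS]big_mkcond; apply: eq_bigr => i _.
  by rewrite inE /paired_tensor; case: paired; rewrite ?expr1n ?expr0n.
have T0 : T != 0.
  apply/eqP => T0; have : mxnorm2 T = 0.
    by rewrite T0 /mxnorm2 big1 // => i _; rewrite big1 // => j _; rewrite mxE expr0n.
  rewrite TE => /eqP; rewrite pnatr_eq0 cards_eq0 => /eqP/setP.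
  move=> /(_ [ffun n => widen_ord (dD n) ord0]); rewrite !inE => /forallP[] n.
  by rewrite !ffunE.
have -> : #|J|%:R * ln (d.+1%:R : R) = - ln q.
  by rewrite lnV ?posrE ?ltr0n ?expn_gt0 // opprK natrX lnXn ?ltr0n // mulr_natl.
apply: QE_mx_ge => // a _ /eigenvalueP[v va v0].
(* By diagonality, a nonzero coordinate of the eigenvector identifies the eigenvalue with a diagonal
   entry. *)
have [i vi] : exists i, v 0 i != 0.
  apply/existsP; apply: contraNT v0 => /existsPn v0; apply/eqP/rowP => i.
  by rewrite mxE; apply/eqP; have := v0 i; rewrite negbK.
have /rowP/(_ i) := va; rewrite !mxE (bigD1 i) //= big1 ?addr0; last first.
  by move=> j ji; rewrite gram_paired (negPf ji) mulr0.
rewrite gram_paired eqxx mulrC => /(mulIf vi) <-.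
rewrite -/T TE /q mulrC ler_pdivlMr ?ltr0n ?expn_gt0 // -natrM ler_nat mulnC.
exact: card_paired.
Qed.

End PairedAxes.

(** With blocks of size B and 2 u B axes in total, m = n B + x and its mirror n B + y would give x +
    y + 1 = 2 B (u - n), impossible as 0 < x + y + 1 < 2 B. *)
Lemma rev_node_axes P L l n (m : 'I_((2 ^ L) ^ P)) : (0 < P)%N -> (l < L)%N ->
  m \in node_axes P L l n -> rev_ord m \notin node_axes P L l n.
Proof.
move=> P0 lL; rewrite !inE => /eqP mn; apply/eqP => /= rn.
have [u uE] : exists u, ((2 ^ L) ^ P = 2 ^ (P * l) * (u + u))%N.
  exists (2 ^ (P * (L - l)).-1)%N; rewrite addnn -mul2n -expnS prednK; last first.
    by rewrite muln_gt0 P0 subn_gt0.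
  by rewrite -expnD -mulnDr subnKC ?(ltnW lL) // mulnC expnM.
have B0 : (0 < 2 ^ (P * l))%N by rewrite expn_gt0.
have := ltn_ord m; have := divn_eq m (2 ^ (P * l)).
have := divn_eq ((2 ^ L) ^ P - m.+1) (2 ^ (P * l)).
have := ltn_pmod m B0; have := ltn_pmod ((2 ^ L) ^ P - m.+1) B0.
rewrite rn mn; case: m {rn mn} => m _ /=; rewrite uE; move: (2 ^ _)%N B0 => B B0.
move: (_ %% _)%N => x; move: (_ %% _)%N => y xB yB e1 e2 mL.
have s : (n * B + n * B + x + y + 1 = B * (u + u))%N by lia.
have : (n < u)%N by rewrite ltnNge; apply/negP => un; have := leq_mul un (leqnn B); lia.
by move=> nu; have := leq_mul nu (leqnn B); rewrite mulSn; lia.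
Qed.

Theorem theorem3 (R : realType) (P L Rw : nat) (D : 'I_((2 ^ L) ^ P) -> nat)
  (hP : (0 < P)%N) (hL : (0 < L)%N) (hD : forall n, (0 < D n)%N) (hR : (0 < Rw)%N)
  (W : tensor R D) (hW : @generated_by_LCTN R P L Rw D W)
  (mu : {ffun 'I_P -> 'I_(2 ^ L)} -> 'I_((2 ^ L) ^ P)) (hmu : @compatible P L mu) :
  (forall (A : tensor R D) (eps : R),
     0 <= eps -> eps <= tnorm A / 4 ->
     tnorm (fun i => W i - A i) <= eps ->
     forall K, @is_canonical P L K ->
       QE A (mu @: K) <=
         ln (Rw%:R) + (2 * eps / tnorm A) * ln ((DJ D (mu @: K))%:R)
         + 2 * Num.sqrt (2 * eps / tnorm A))
  /\
  (exists A' : tensor R D,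
     forall K, @is_canonical P L K ->
       QE A' (mu @: K) >= (minn #|K| #|~: K|)%:R * ln ((min_dim D)%:R)).
Proof.
split=> [A eps e0 eA WA K Kc|].
  have [l [n [lL nl -> _]]] := compatible_canonical hP hmu Kc.
  by apply: QE_le e0 eA WA => //; apply: rank_LCTN.
have M0 : (0 < (2 ^ L) ^ P)%N by rewrite !expn_gt0.
have d0 := min_dim_gt0 M0 hD; pose d := (min_dim D).-1.
have dE : d.+1 = min_dim D by rewrite prednK.
have dD n : (d.+1 <= D n)%N by rewrite dE min_dim_le.
exists (@paired_tensor R _ D (@rev_ord _) d) => K Kc.
have [l [n [lL nl muK cardK]]] := compatible_canonical hP hmu Kc.
(* For l = L the block is the whole grid and the bound is 0; below the root the mirror argument
   applies. *)
move: lL; rewrite leq_eqVlt => /predU1P[lL|lL].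
  have -> : #|~: K| = 0%N.
    by rewrite cardsCs finset.setCK cardK card_ffun !card_ord lL mulnC expnM subnn.
  by rewrite minn0 mul0r; apply: QE_mx_ge0.
apply: le_trans (QE_paired R rev_ordK dD _); last first.
  by move=> m; rewrite muK; apply: rev_node_axes.
rewrite dE ler_wpM2r ?ln_ge0 ?ler1n // ler_nat muK (card_node_axes (ltnW lL) nl).
by rewrite -cardK geq_minl.
Qed.
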